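(* For real parameters $r_2,\theta_2,r_3,\theta_3$, with $E_{ab}$ the $4\times4$ matrix units, let $$F_{r_2r_3}=2\sinh 2r_2\,\big(-e^{-i\theta_3}E_{23}+e^{i\theta_3}E_{32}\big),\qquad F_{r_2\theta_3}=i\sin 2r_3\sinh 2r_2\,\big(e^{-i\theta_3}E_{23}+e^{i\theta_3}E_{32}\big),$$ $$F_{r_3\theta_3}=i\sin 2r_3\sinh^2 2r_2\,\big(-E_{22}+E_{33}\big),$$ $$D=2\sinh^2 2r_2\,\big(-e^{-i\theta_2}E_{14}+e^{i\theta_2}E_{41}\big),\qquad \tilde D=4i\sinh 2r_2\,\big(-e^{-i\theta_2}E_{14}-e^{i\theta_2}E_{41}\big).$$ From the set $\{F_{r_2r_3},F_{r_2\theta_3},F_{r_3\theta_3},D,\tilde D\}$ and the local algebra (defined in the context) one obtains, by taking iterated brackets, a set spanning $\mathfrak{su}(4)$. One choice of spanning elements is $\mathcal C_1\cup\mathcal C_2\cup\mathcal C_3$, where $$\mathcal C_1=\{iI_{x1},iI_{y1},iI_{z1},iI_{x2},iI_{y2},iI_{z2}\},\qquad \mathcal C_2=\{F_{r_2r_3},F_{r_2\theta_3},D,\tilde D\},$$ $$\mathcal C_3=\big\{[iI_{x1},F_{r_2r_3}],\ [iI_{x1},F_{r_2\theta_3}],\ [iI_{x2},F_{r_2r_3}],\ [iI_{x2},F_{r_2\theta_3}],\ \big[[iI_{x1},F_{r_2r_3}],iI_{x2}\big]\big\}.$$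
   Context: Let $I_x=\frac12\begin{pmatrix}0&1\\1&0\end{pmatrix}$, $I_y=\frac12\begin{pmatrix}0&-i\\i&0\end{pmatrix}$, $I_z=\frac12\begin{pmatrix}1&0\\0&-1\end{pmatrix}$, let $\mathbf 1$ be the $2\times2$ identity, and $I_{k1}=I_k\otimes\mathbf 1$, $I_{k2}=\mathbf 1\otimes I_k$ for $k\in\{x,y,z\}$, viewed as $4\times4$ matrices in the ordered basis $|00\rangle,|01\rangle,|10\rangle,|11\rangle$ of $\mathbb C^2\otimes\mathbb C^2$. The local algebra is the Lie algebra of $SU(2)\otimes SU(2)$, spanned over $\mathbb R$ by the $iI_{k1}$ and $iI_{k2}$. $\mathfrak{su}(4)$ is the real Lie algebra of traceless anti-Hermitian $4\times4$ complex matrices, and $[X,Y]=XY-YX$. Origin of the matrices: in the two-mode squeezed coherent state model of holonomic quantum computation, with two-mode displacement parameter $\xi=r_3e^{i\theta_3}$ and two-mode squeezing parameter $\zeta=r_2e^{i\theta_2}$, the matrices $F_{r_2r_3}$, $F_{r_2\theta_3}$, $F_{r_3\theta_3}$ are components of the local curvature of the Wilczek-Zee connection in the coordinates $(r_2,\theta_2,r_3,\theta_3)$, $D=D_{\partial/\partial\theta_2}F_{r_2\theta_2}$ is a covariant derivative of the curvature, and $\tilde D$ is a linear combination of $D_{\partial/\partial r_2}F_{r_2\theta_2}$ and the curvature component $F_{r_2\theta_2}$. Together with single-qubit $SU(2)$ holonomies these describe the transformations available on two qubits.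
   Formalization: The claim fails for some real parameters, so generation of su(4) is stated for r_2≠0, and spanning by C_1∪C_2∪C_3 for r_2≠0, sin 2r_3≠0 and sin θ_3≠0; otherwise one of the listed elements vanishes, leaving fewer than 15. *)

(* Defs.v *)
From mathcomp Require Import all_boot all_order all_algebra.
From mathcomp Require Import complex mxtens.
From mathcomp Require Import classical_sets reals sequences exp trigo.

Set Implicit Arguments.
Unset Strict Implicit.
Unset Printing Implicit Defensive.

Import Order.TTheory GRing.Theory Num.Theory.
Local Open Scope classical_set_scope.
Local Open Scope ring_scope.
Local Open Scope complex_scope.
Local Open Scope sesquilinear_scope.

Section LieMatrices.
Variable R : realType.

Definition bracket n (X Y : 'M[R[i]]_n) : 'M[R[i]]_n := X *m Y - Y *m X.

Definition su n : set 'M[R[i]]_n := [set X | X^t* = - X /\ \tr X = 0].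

(* The linear span with real coefficients: 'M[R[i]]_n carries only its
   complex vector space structure, so the real scalars are injected by %:C. *)
Definition real_span n (S : set 'M[R[i]]_n) : set 'M[R[i]]_n :=
  [set X | exists (k : nat) (c : 'I_k -> R) (A : 'I_k -> 'M[R[i]]_n),
     (forall j, S (A j)) /\ X = \sum_(j < k) (c j)%:C *: A j].

(* Brackets of all depths and all nestings, depth zero included. *)
Inductive iterated_brackets n (S : set 'M[R[i]]_n) : set 'M[R[i]]_n :=
| IterGen X : S X -> iterated_brackets S X
| IterBracket X Y : iterated_brackets S X -> iterated_brackets S Y ->
    iterated_brackets S (bracket X Y).

End LieMatrices.

Section TwoQubits.
Variable R : realType.
Local Notation M2 := 'M[R[i]]_2.
Local Notation M4 := 'M[R[i]]_4.

Definition imag : R[i] := 0 +i* 1.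

Definition spin_x : M2 := 2^-1 *: (delta_mx 0 1 + delta_mx 1 0).
Definition spin_y : M2 := 2^-1 *: (- imag *: delta_mx 0 1 + imag *: delta_mx 1 0).
Definition spin_z : M2 := 2^-1 *: (delta_mx 0 0 - delta_mx 1 1).

(* The index (a, b) of a Kronecker product is 2 * a + b, so the basis order is
   |00>, |01>, |10>, |11>. *)
Definition on_fst (A : M2) : M4 := tensmx A (1%:M : M2).
Definition on_snd (A : M2) : M4 := tensmx (1%:M : M2) A.

Definition iIx1 : M4 := imag *: on_fst spin_x.
Definition iIy1 : M4 := imag *: on_fst spin_y.
Definition iIz1 : M4 := imag *: on_fst spin_z.
Definition iIx2 : M4 := imag *: on_snd spin_x.
Definition iIy2 : M4 := imag *: on_snd spin_y.
Definition iIz2 : M4 := imag *: on_snd spin_z.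

Definition C1 : set M4 := [set iIx1; iIy1; iIz1; iIx2; iIy2; iIz2].

Definition local_algebra : set M4 := real_span C1.

Definition sinh (x : R) : R := (expR x - expR (- x)) / 2.

(* e^{it} *)
Definition cis (t : R) : R[i] := cos t +i* sin t.

(* Matrix units, with rows and columns numbered 1, 2, 3, 4. *)
Definition E (a b : nat) : M4 := delta_mx (inord a.-1) (inord b.-1).

Definition F_r2r3 (r2 th3 : R) : M4 :=
  (2 * sinh (2 * r2))%:C *: (- cis (- th3) *: E 2 3 + cis th3 *: E 3 2).

Definition F_r2th3 (r2 r3 th3 : R) : M4 :=
  (imag * (sin (2 * r3) * sinh (2 * r2))%:C) *:
    (cis (- th3) *: E 2 3 + cis th3 *: E 3 2).

Definition F_r3th3 (r2 r3 : R) : M4 :=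
  (imag * (sin (2 * r3) * sinh (2 * r2) ^+ 2)%:C) *: (- E 2 2 + E 3 3).

Definition D (r2 th2 : R) : M4 :=
  (2 * sinh (2 * r2) ^+ 2)%:C *: (- cis (- th2) *: E 1 4 + cis th2 *: E 4 1).

Definition D_tilde (r2 th2 : R) : M4 :=
  (4 * imag * (sinh (2 * r2))%:C) *:
    (- cis (- th2) *: E 1 4 - cis th2 *: E 4 1).

Definition curvature_set (r2 th2 r3 th3 : R) : set M4 :=
  [set F_r2r3 r2 th3; F_r2th3 r2 r3 th3; F_r3th3 r2 r3; D r2 th2; D_tilde r2 th2].

Definition C2 (r2 th2 r3 th3 : R) : set M4 :=
  [set F_r2r3 r2 th3; F_r2th3 r2 r3 th3; D r2 th2; D_tilde r2 th2].

Definition C3 (r2 r3 th3 : R) : set M4 :=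
  [set bracket iIx1 (F_r2r3 r2 th3);
       bracket iIx1 (F_r2th3 r2 r3 th3);
       bracket iIx2 (F_r2r3 r2 th3);
       bracket iIx2 (F_r2th3 r2 r3 th3);
       bracket (bracket iIx1 (F_r2r3 r2 th3)) iIx2].

End TwoQubits.

Arguments su : clear implicits.
Arguments C1 : clear implicits.
Arguments local_algebra : clear implicits.

(* Main.v *)
Require Import Defs.
From mathcomp Require Import all_boot all_order all_algebra.
From mathcomp Require Import complex mxtens ring.
From mathcomp Require Import classical_sets reals exp trigo.

(** Write [N A B = i A (x) B] ([i_tens]). Matrix units of C^4 are tensor
    products of matrix units of C^2, hence complex combinations of tensor
    products of the identity and the spins; taking traceless anti-Hermitian
    parts, su(4) is the real span of C1 and the nine [N I_a I_b]. Up to real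
    factors that are nonzero when r2 and sin(2 r3) are, (F_r2r3, F_r2th3) is
    the rotation by th3 of the pair (N xx + N yy, N xy - N yx), and (D~, D) is
    the rotation by th2 of (N xy + N yx, N xx - N yy); so C2 spans N xx, N yy,
    N xy, N yx. Bracketing the first pair with I_x1 and I_x2 gives N zx, N zy,
    N xz, N yz, and the double bracket is a nonzero multiple of sinh(2 r2)
    sin(th3) N zz. For the generated algebra D and D~ alone suffice: they yield
    N xx - N yy, whose bracket with I_x1 is N zy, and the local algebra acts
    irreducibly on the span of the nine [N I_a I_b]. *)

Set Implicit Arguments.
Unset Strict Implicit.
Unset Printing Implicit Defensive.

Import Order.TTheory GRing.Theory Num.Theory.
Local Open Scope classical_set_scope.
Local Open Scope ring_scope.
Local Open Scope complex_scope.
Local Open Scope sesquilinear_scope.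

(** * Real subspaces of complex matrices and real spans *)

Record real_subspace (R : realType) n (V : set 'M[R[i]]_n) : Prop :=
  RealSubspace {
    real_subspace0 : V 0;
    real_subspaceD : forall X Y, V X -> V Y -> V (X + Y);
    real_subspaceZ : forall (c : R) X, V X -> V (c%:C *: X) }.

Lemma real_subspaceN (R : realType) n (V : set 'M[R[i]]_n) X :
  real_subspace V -> V X -> V (- X).
Proof.
by move=> hV VX; rewrite -scaleN1r -[-1](rmorphN1 (real_complex R));
  exact: real_subspaceZ.
Qed.

Lemma real_subspaceB (R : realType) n (V : set 'M[R[i]]_n) X Y :
  real_subspace V -> V X -> V Y -> V (X - Y).
Proof.
by move=> hV VX VY; apply: real_subspaceD => //; exact: real_subspaceN.
Qed.

Lemma real_subspaceZV (R : realType) n (V : set 'M[R[i]]_n) (c : R) X :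
  real_subspace V -> c != 0 -> V (c%:C *: X) -> V X.
Proof.
move=> hV c0 VcX; rewrite -[X]scale1r -(rmorph1 (real_complex R)).
by rewrite -(mulVf c0) rmorphM -scalerA; exact: real_subspaceZ.
Qed.

Lemma real_subspace_sum (R : realType) n (V : set 'M[R[i]]_n)
    (I : Type) (r : seq I) (P : pred I) (F : I -> 'M[R[i]]_n) :
  real_subspace V -> (forall i, P i -> V (F i)) -> V (\sum_(i <- r | P i) F i).
Proof.
by move=> hV VF; apply: big_ind => //;
  [exact: real_subspace0 | move=> X Y; exact: real_subspaceD].
Qed.

Lemma real_span_subspace (R : realType) n (S : set 'M[R[i]]_n) :
  real_subspace (real_span S).
Proof.
split=> [|X Y [k [c [A [SA ->]]]] [l [d [B [SB ->]]]]|a X [k [c [A [SA ->]]]]].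
- exists 0, (fun=> 0), (fun=> 0); split; first by case.
  by rewrite big_ord0.
- exists (k + l)%N,
    (fun j => match split j with inl i => c i | inr i => d i end),
    (fun j => match split j with inl i => A i | inr i => B i end); split.
    by move=> j; case: splitP.
  rewrite big_split_ord; congr (_ + _); apply: eq_bigr => j _.
    by rewrite (unsplitK (inl _ j)).
  by rewrite (unsplitK (inr _ j)).
- exists k, (fun j => a * c j), A; split=> //.
  by rewrite scaler_sumr; apply: eq_bigr => j _; rewrite scalerA -rmorphM.
Qed.

Lemma sub_real_span (R : realType) n (S : set 'M[R[i]]_n) : S `<=` real_span S.
Proof.
move=> X SX; exists 1, (fun=> 1), (fun=> X); split=> //.
by rewrite big_ord1 scale1r.
Qed.

Lemma real_span_min (R : realType) n (S V : set 'M[R[i]]_n) :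
  real_subspace V -> S `<=` V -> real_span S `<=` V.
Proof.
move=> hV SV _ [k [c [A [SA ->]]]]; apply: real_subspace_sum => // j _.
by apply: real_subspaceZ => //; apply: SV.
Qed.

(** * Linearity and antisymmetry of the bracket *)

Lemma bracketDr (R : realType) n (X Y Z : 'M[R[i]]_n) :
  bracket X (Y + Z) = bracket X Y + bracket X Z.
Proof. by rewrite /bracket mulmxDr mulmxDl opprD addrACA. Qed.

Lemma bracketZr (R : realType) n (a : R[i]) (X Y : 'M[R[i]]_n) :
  bracket X (a *: Y) = a *: bracket X Y.
Proof. by rewrite /bracket -scalemxAr -scalemxAl scalerBr. Qed.

Lemma bracketNr (R : realType) n (X Y : 'M[R[i]]_n) :
  bracket X (- Y) = - bracket X Y.
Proof. by rewrite -scaleN1r bracketZr scaleN1r. Qed.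

Lemma bracket_anti (R : realType) n (X Y : 'M[R[i]]_n) :
  bracket X Y = - bracket Y X.
Proof. by rewrite /bracket opprB. Qed.

Lemma bracketxx (R : realType) n (X : 'M[R[i]]_n) : bracket X X = 0.
Proof. exact: subrr. Qed.

(** Bracketing with a fixed generator is linear and maps iterated brackets to iterated brackets.
    This makes the span stable under the adjoint action of [C1], which drives the generation
    argument. *)
Lemma real_span_bracket_gen (R : realType) n (S : set 'M[R[i]]_n) A X :
  S A -> real_span (iterated_brackets S) X ->
  real_span (iterated_brackets S) (bracket A X).
Proof.
move=> SA [k [c [B [SB ->]]]].
have hV := real_span_subspace (iterated_brackets S).
have -> : bracket A (\sum_(j < k) (c j)%:C *: B j)
        = \sum_(j < k) (c j)%:C *: bracket A (B j).
  elim/big_ind2: _ => [|_ Y _ Z <- <-|j _].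
  - by rewrite /bracket mulmx0 mul0mx subrr.
  - by rewrite bracketDr.
  - by rewrite bracketZr.
apply: real_subspace_sum => // j _; apply: real_subspaceZ => //.
by apply: sub_real_span; apply: IterBracket => //; exact: IterGen.
Qed.

(** * Adjoints, and su(n) as a real Lie algebra *)

Lemma adjoint_mul (R : realType) n (X Y : 'M[R[i]]_n) :
  (X *m Y)^t* = Y^t* *m X^t*.
Proof. by rewrite trmx_mul map_mxM. Qed.

Lemma adjointD (R : realType) n (X Y : 'M[R[i]]_n) :
  (X + Y)^t* = X^t* + Y^t*.
Proof. by rewrite linearD map_mxD. Qed.

Lemma adjointN (R : realType) n (X : 'M[R[i]]_n) : (- X)^t* = - X^t*.
Proof. by rewrite linearN map_mxN. Qed.

Lemma adjointZ (R : realType) n (a : R[i]) (X : 'M[R[i]]_n) :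
  (a *: X)^t* = (a^*)%R *: X^t*.
Proof. by rewrite linearZ map_mxZ. Qed.

Lemma su_subspace (R : realType) n : real_subspace (su R n).
Proof.
split=> [|X Y [aX tX] [aY tY]|a X [aX tX]].
- by split; rewrite ?mxtrace0 // trmx0 map_mx0 oppr0.
- by split; rewrite ?mxtraceD ?tX ?tY ?addr0 // adjointD aX aY opprD.
- split; rewrite ?mxtraceZ ?tX ?mulr0 // adjointZ aX scalerN.
  by congr (- (_ *: _)); exact: conjc_real.
Qed.

Lemma su_bracket (R : realType) n X Y :
  su R n X -> su R n Y -> su R n (bracket X Y).
Proof.
move=> [aX _] [aY _]; split.
  by rewrite adjointD adjointN !adjoint_mul aX aY !mulNmx !mulmxN !opprK opprB.
by rewrite linearB /= mxtrace_mulC subrr.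
Qed.

(** * Kronecker products *)

Lemma adjoint_tensmx (R : realType) (A B : 'M[R[i]]_2) :
  (tensmx A B)^t* = tensmx (A^t*) (B^t*).
Proof. by rewrite trmx_tens map_mxT. Qed.

Lemma mxtrace_tensmx (K : pzRingType) m n (A : 'M[K]_m) (B : 'M[K]_n) :
  \tr (tensmx A B) = \tr A * \tr B.
Proof. by rewrite mulr_sum; apply: eq_bigr => i _; rewrite mxE. Qed.

Lemma tensmx_delta (K : pzRingType) m n (i j : 'I_m) (k l : 'I_n) :
  tensmx (delta_mx i j) (delta_mx k l) =
  delta_mx (mxtens_index (i, k)) (mxtens_index (j, l)) :> 'M[K]_(m * n).
Proof.
apply/matrixP => a b.
case: (mxtens_indexP a) => a1 a2; case: (mxtens_indexP b) => b1 b2.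
rewrite tensmxE !mxE !(can_eq (@mxtens_indexK m n)) !xpair_eqE.
by rewrite -natrM mulnb andbACA.
Qed.

Lemma tensmxDl (K : pzRingType) m n p q
    (A B : 'M[K]_(m, n)) (C : 'M[K]_(p, q)) :
  tensmx (A + B) C = tensmx A C + tensmx B C.
Proof. by apply/matrixP => i j; rewrite !mxE mulrDl. Qed.

Lemma tensmxDr (K : pzRingType) m n p q
    (A : 'M[K]_(m, n)) (B C : 'M[K]_(p, q)) :
  tensmx A (B + C) = tensmx A B + tensmx A C.
Proof. by apply/matrixP => i j; rewrite !mxE mulrDr. Qed.

Lemma tensmxZl (K : pzRingType) m n p q
    a (A : 'M[K]_(m, n)) (C : 'M[K]_(p, q)) :
  tensmx (a *: A) C = a *: tensmx A C.
Proof. by apply/matrixP => i j; rewrite !mxE mulrA. Qed.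

Lemma tensmxZr (K : comPzRingType) m n p q
    a (A : 'M[K]_(m, n)) (C : 'M[K]_(p, q)) :
  tensmx A (a *: C) = a *: tensmx A C.
Proof. by apply/matrixP => i j; rewrite !mxE mulrCA. Qed.

Lemma tensmxNl (K : pzRingType) m n p q (A : 'M[K]_(m, n)) (C : 'M[K]_(p, q)) :
  tensmx (- A) C = - tensmx A C.
Proof. by apply/matrixP => i j; rewrite !mxE mulNr. Qed.

Lemma tensmxNr (K : pzRingType) m n p q (A : 'M[K]_(m, n)) (C : 'M[K]_(p, q)) :
  tensmx A (- C) = - tensmx A C.
Proof. by apply/matrixP => i j; rewrite !mxE mulrN. Qed.

(** * Spin matrices and their commutation relations *)

Lemma imagM (R : realType) : imag R * imag R = -1.
Proof. by rewrite -expr2; exact: sqr_i. Qed.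

Lemma conj_imag (R : realType) : ((imag R)^* = - imag R)%R.
Proof. by apply/eqP; rewrite eq_complex /= oppr0 !eqxx. Qed.

Definition spins (R : realType) : set 'M[R[i]]_2 :=
  [set spin_x R; spin_y R; spin_z R].
Arguments spins : clear implicits.

(** The raising operator; the next three lemmas treat the lowering operator and the projections onto
    the two basis states. *)
Lemma delta01_spin (R : realType) :
  delta_mx 0 1 = spin_x R + imag R *: spin_y R.
Proof.
by apply/matrixP => -[[|[|//]] ?] [[|[|//]] ?]; rewrite !mxE /=;
  field: (imagM R).
Qed.

Lemma delta10_spin (R : realType) :
  delta_mx 1 0 = spin_x R - imag R *: spin_y R.
Proof.
by apply/matrixP => -[[|[|//]] ?] [[|[|//]] ?]; rewrite !mxE /=;
  field: (imagM R).
Qed.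

Lemma delta00_spin (R : realType) :
  delta_mx 0 0 = 2^-1 *: 1%:M + spin_z R.
Proof.
by apply/matrixP => -[[|[|//]] ?] [[|[|//]] ?]; rewrite !mxE /=; field.
Qed.

Lemma delta11_spin (R : realType) :
  delta_mx 1 1 = 2^-1 *: 1%:M - spin_z R.
Proof.
by apply/matrixP => -[[|[|//]] ?] [[|[|//]] ?]; rewrite !mxE /=; field.
Qed.

(** The four matrix units are complex combinations of the identity and the spins, which therefore
    span all 2 x 2 matrices. *)
Lemma mx2_spin_ind (R : realType) (P : set 'M[R[i]]_2) :
  (forall A B, P A -> P B -> P (A + B)) -> (forall a A, P A -> P (a *: A)) ->
  P 1%:M -> spins R `<=` P -> forall A, P A.
Proof.
move=> PD PZ P1 Pspin A.
have PB B C : P B -> P C -> P (B - C).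
  by move=> PB PC; apply: PD => //; rewrite -scaleN1r; exact: PZ.
have [Px Py Pz] : [/\ P (spin_x R), P (spin_y R) & P (spin_z R)].
  by split; apply: Pspin; [left; left | left; right | right].
rewrite (matrix_sum_delta A); apply: big_ind => // [|i _].
  (* Membership of zero comes from scaling the identity by 0. *)
  by rewrite -(scale0r 1%:M); exact: PZ.
apply: big_ind => // [|j _]; first by rewrite -(scale0r 1%:M); exact: PZ.
have P00 : P (delta_mx 0 0) by rewrite delta00_spin; apply: PD; first exact: PZ.
have P01 : P (delta_mx 0 1) by rewrite delta01_spin; apply: PD; last exact: PZ.
have P10 : P (delta_mx 1 0) by rewrite delta10_spin; apply: PB; last exact: PZ.
have P11 : P (delta_mx 1 1) by rewrite delta11_spin; apply: PB; first exact: PZ.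
have ord2 (k : 'I_2) : k = 0 \/ k = 1.
  by case: k => -[|[|//]] ?; [left | right]; exact: val_inj.
apply: (PZ).
by case: (ord2 i) => ->; case: (ord2 j) => ->.
Qed.

(* Stated over an abstract field because unification between entries of
   distinct concrete complex matrices unfolds the construction of [R[i]]. *)
Lemma pauli_bracket (K : fieldType) (w : K) (X Y Z : 'M[K]_2) :
  w * w = -1 -> (2 : K) != 0 ->
  X = 2^-1 *: (delta_mx 0 1 + delta_mx 1 0) ->
  Y = 2^-1 *: (- w *: delta_mx 0 1 + w *: delta_mx 1 0) ->
  Z = 2^-1 *: (delta_mx 0 0 - delta_mx 1 1) ->
  [/\ w *: (X *m Y - Y *m X) = - Z, w *: (Y *m Z - Z *m Y) = - X &
      w *: (Z *m X - X *m Z) = - Y].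
Proof.
move=> w2 two_neq0 -> -> ->.
by split; apply/matrixP => i j; rewrite !(mxE, big_ord_recl, big_ord0);
  case: i j => -[|[|//]] ? [[|[|//]] ?]; rewrite /=; field: w2.
Qed.

(** The factor i is the one that [bracket_i_tens_fst] and [bracket_i_tens_snd] leave inside a tensor
    factor. *)
Lemma spin_bracket (R : realType) :
  [/\ imag R *: bracket (spin_x R) (spin_y R) = - spin_z R,
      imag R *: bracket (spin_y R) (spin_z R) = - spin_x R &
      imag R *: bracket (spin_z R) (spin_x R) = - spin_y R].
Proof. by apply: pauli_bracket; rewrite ?imagM ?pnatr_eq0. Qed.

Lemma spin_traceless (R : realType) A : spins R A -> \tr A = 0.
Proof.
by case=> [[->|->]|->]; rewrite /mxtrace !big_ord_recl big_ord0 !mxE /=; field.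
Qed.

Lemma adjoint_delta_mx (R : realType) n (i j : 'I_n) :
  (delta_mx i j : 'M[R[i]]_n)^t* = delta_mx j i.
Proof. by rewrite trmx_delta map_delta_mx. Qed.

Lemma spin_hermitian (R : realType) A : spins R A -> A^t* = A.
Proof.
have h2 : ((2^-1 : R[i])^*)%R = 2^-1 by rewrite fmorphV rmorph_nat.
case=> [[->|->]|->]; rewrite adjointZ h2 /=.
- by rewrite adjointD !adjoint_delta_mx addrC.
- rewrite adjointD !adjointZ !adjoint_delta_mx rmorphN /= conj_imag opprK.
  by rewrite addrC.
- by rewrite adjointD adjointN !adjoint_delta_mx.
Qed.

(** * Brackets of the products i A (x) B *)

Definition i_tens (R : realType) (A B : 'M[R[i]]_2) : 'M[R[i]]_4 :=
  imag R *: tensmx A B.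

Lemma i_tensNl (R : realType) (A B : 'M[R[i]]_2) :
  i_tens (- A) B = - i_tens A B.
Proof. by rewrite /i_tens tensmxNl scalerN. Qed.

Lemma i_tensNr (R : realType) (A B : 'M[R[i]]_2) :
  i_tens A (- B) = - i_tens A B.
Proof. by rewrite /i_tens tensmxNr scalerN. Qed.

Lemma i_tensNN (R : realType) (A B : 'M[R[i]]_2) :
  i_tens (- A) (- B) = i_tens A B.
Proof. by rewrite i_tensNl i_tensNr opprK. Qed.

Lemma i_tens0r (R : realType) (A : 'M[R[i]]_2) : i_tens A 0 = 0.
Proof. by rewrite /i_tens tensmx0 scaler0. Qed.

(** The mixed-product rule with the size 2 * 2 presented as 4, the form in which the products occur
    in brackets on C^4. *)
Lemma tensmx_mul22 (R : realType) (A B C D : 'M[R[i]]_2) :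
  (tensmx A B : 'M_4) *m (tensmx C D : 'M_4) = tensmx (A *m C) (B *m D).
Proof. exact: (@tensmx_mul R[i] 2 2 2 2 2 2 A B C D). Qed.

(** Of the two factors i, one moves next to [A, B], so that the result is again an [i_tens]. For a
    spin [A], [i_tens A 1%:M] is convertible with a generator in [C1]. *)
Lemma bracket_i_tens_fst (R : realType) (A B C : 'M[R[i]]_2) :
  bracket (i_tens A 1%:M) (i_tens B C) = i_tens (imag R *: bracket A B) C.
Proof.
rewrite /bracket /i_tens -!scalemxAl -!scalemxAr !tensmx_mul22 mul1mx mulmx1.
by rewrite tensmxZl tensmxDl tensmxNl !scalerBr.
Qed.

Lemma bracket_i_tens_snd (R : realType) (A B C : 'M[R[i]]_2) :
  bracket (i_tens 1%:M A) (i_tens B C) = i_tens B (imag R *: bracket A C).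
Proof.
rewrite /bracket /i_tens -!scalemxAl -!scalemxAr !tensmx_mul22 mul1mx mulmx1.
by rewrite tensmxZr tensmxDr tensmxNr !scalerBr.
Qed.

Lemma su_i_tens (R : realType) (A B : 'M[R[i]]_2) :
  A^t* = A -> B^t* = B -> \tr A * \tr B = 0 -> su R 4 (i_tens A B).
Proof.
move=> hA hB tAB; split.
  by rewrite adjointZ adjoint_tensmx hA hB conj_imag scaleNr.
have trE : \tr (tensmx A B : 'M_4) = \tr A * \tr B := mxtrace_tensmx A B.
by rewrite mxtraceZ trE tAB mulr0.
Qed.

(** * A spanning criterion for su(4) *)

Lemma tensmx11 (K : pzRingType) m n :
  tensmx (1%:M : 'M[K]_m) (1%:M : 'M[K]_n) = 1%:M.
Proof.
apply/matrixP => a b.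
case: (mxtens_indexP a) => a1 a2; case: (mxtens_indexP b) => b1 b2.
by rewrite tensmxE !mxE (can_eq (@mxtens_indexK m n)) xpair_eqE -natrM mulnb.
Qed.

(* [psi X] is twice the traceless anti-Hermitian part of [X]: it doubles the
   elements of su(4), and on a tensor product of Hermitian factors it retains
   a real multiple of [i_tens]. *)
Lemma su4_sub (R : realType) (V : set 'M[R[i]]_4) :
  real_subspace V -> C1 R `<=` V ->
  (forall A B, spins R A -> spins R B -> V (i_tens A B)) -> su R 4 `<=` V.
Proof.
move=> hV C1V Vspin.
pose psi (X : 'M[R[i]]_4) := X - X^t* - (\tr (X - X^t*) / 4) *: 1%:M.
have psiD (X Y : 'M[R[i]]_4) : psi (X + Y) = psi X + psi Y.
  rewrite /psi; have -> : X + Y - (X + Y)^t* = (X - X^t*) + (Y - Y^t*).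
    by rewrite adjointD opprD addrACA.
  by rewrite mxtraceD mulrDl scalerDl opprD addrACA.
have psi_herm (c : R[i]) A B : A^t* = A -> B^t* = B -> \tr A * \tr B = 0 ->
    V (i_tens A B) -> V (psi (c *: (tensmx A B : 'M_4))).
  move=> hA hB tAB VAB.
  have trE : \tr (tensmx A B : 'M_4) = \tr A * \tr B := mxtrace_tensmx A B.
  rewrite /psi adjointZ adjoint_tensmx hA hB -scalerBl mxtraceZ trE tAB.
  rewrite mulr0 mul0r scale0r subr0.
  (* For Hermitian factors the adjoint only conjugates [c], so what remains is c - conj c, a real
     multiple of i. *)
  have cE : c - conjc c = (2 * complex.Im c)%:C * imag R.
    by rewrite rmorphM rmorph_nat; exact: subcJ.
  by rewrite [X in X *: _]cE -scalerA; exact: real_subspaceZ.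
(* Multiples of the identity are removed by the trace correction. *)
have psi1 (c : R[i]) :
    V (psi (c *: (tensmx (1%:M : 'M_2) (1%:M : 'M_2) : 'M_4))).
  have -> : tensmx (1%:M : 'M_2) (1%:M : 'M_2) = 1%:M :> 'M[R[i]]_4.
    exact: (@tensmx11 R[i] 2 2).
  rewrite /psi adjointZ trmx1 map_mx1 -scalerBl mxtraceZ mxtrace1.
  by rewrite mulfK ?pnatr_eq0 // subrr; exact: real_subspace0.
have adj1 : (1%:M : 'M[R[i]]_2)^t* = 1%:M by rewrite trmx1 map_mx1.
have V1 A : spins R A -> V (i_tens 1%:M A).
  by case=> [[->|->]|->]; apply: C1V; rewrite /C1;
    [left; left; right | left; right | right].
have V2 A : spins R A -> V (i_tens A 1%:M).
  case=> [[->|->]|->]; apply: C1V; rewrite /C1.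
  - by left; left; left; left; left.
  - by left; left; left; left; right.
  - by left; left; left; right.
(* Quantifying over the complex scalar [c] makes the predicate closed under complex scaling,
   although [V] is only a real subspace. *)
have psi_tens (A : 'M_2) : forall (c : R[i]) (B : 'M_2),
    V (psi (c *: (tensmx A B : 'M_4))).
  move: A; apply: mx2_spin_ind => [A A' hA hA' c B|a A hA c B|c B|A sA c B].
  - by rewrite tensmxDl scalerDr psiD; apply: real_subspaceD.
  - by rewrite tensmxZl scalerA.
  - move: B c; apply: mx2_spin_ind => [B B' hB hB' c|b B hB c|c|B sB c].
    + by rewrite tensmxDr scalerDr psiD; apply: real_subspaceD.
    + by rewrite tensmxZr scalerA.
    + exact: psi1.
    + apply: psi_herm; [exact: adj1| exact: spin_hermitian | | exact: V1].
      by rewrite (spin_traceless sB) mulr0.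
  - move: B c; apply: mx2_spin_ind => [B B' hB hB' c|b B hB c|c|B sB c].
    + by rewrite tensmxDr scalerDr psiD; apply: real_subspaceD.
    + by rewrite tensmxZr scalerA.
    + apply: psi_herm; [exact: spin_hermitian | exact: adj1 | | exact: V2].
      by rewrite (spin_traceless sA) mul0r.
    + apply: psi_herm; [exact: spin_hermitian | exact: spin_hermitian | |].
        by rewrite (spin_traceless sA) mul0r.
      exact: Vspin.
have psi_all X : V (psi X).
  have psi0 : V (psi 0).
    rewrite /psi trmx0 map_mx0 subrr mxtrace0 mul0r scale0r subrr.
    exact: real_subspace0.
  rewrite (matrix_sum_delta X).
  apply: (big_ind (fun X => V (psi X))) => // [Y Z VY VZ|i _].
    by rewrite psiD; exact: real_subspaceD.
  apply: (big_ind (fun X => V (psi X))) => // [Y Z VY VZ|j _].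
    by rewrite psiD; exact: real_subspaceD.
  move: (X i j) => c {X}.
  (* Splitting both indices into pairs exhibits the 4 x 4 matrix unit as a tensor product of 2 x 2
     ones. *)
  case: (@mxtens_indexP 2 2 i) => i1 i2; case: (@mxtens_indexP 2 2 j) => j1 j2.
  have := psi_tens (delta_mx i1 j1) c (delta_mx i2 j2).
  by rewrite (@tensmx_delta R[i] 2 2 i1 j1 i2 j2).
move=> X [aX tX].
apply: (@real_subspaceZV _ _ _ 2 _ hV); first by rewrite pnatr_eq0.
have := psi_all X; rewrite /psi aX opprK mxtraceD tX addr0 mul0r scale0r subr0.
by rewrite rmorph_nat -mulr2n -scaler_nat.
Qed.

(** * The curvature matrices in terms of spins *)

Lemma E_tens (R : realType) (i j k l : 'I_2) :
  E R (2 * i + k).+1 (2 * j + l).+1 =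
  tensmx (delta_mx i j) (delta_mx k l) :> 'M[R[i]]_4.
Proof.
rewrite (@tensmx_delta R[i] 2 2 i j k l) /E.
(* [E] numbers rows and columns from 1 and [mxtens_index] from 0, whence the successors. *)
by congr delta_mx; apply: val_inj; rewrite /= inordK /= 1?mulnC //;
  [case: i k => -[|[|//]] ? [[|[|//]] ?]
  |case: j l => -[|[|//]] ? [[|[|//]] ?]].
Qed.

(** For [X] = I_x, [Y] = I_y and [w] = i the left sides are products of raising and lowering
    operators: E_23, E_32, E_14 and E_41, in this order. *)
Lemma tensmx_square (K : comPzRingType) (w : K) (X Y : 'M[K]_2) :
  w * w = -1 ->
  [/\ tensmx (X + w *: Y) (X - w *: Y) =
        tensmx X X + tensmx Y Y - w *: (tensmx X Y - tensmx Y X),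
      tensmx (X - w *: Y) (X + w *: Y) =
        tensmx X X + tensmx Y Y + w *: (tensmx X Y - tensmx Y X),
      tensmx (X + w *: Y) (X + w *: Y) =
        tensmx X X - tensmx Y Y + w *: (tensmx X Y + tensmx Y X) &
      tensmx (X - w *: Y) (X - w *: Y) =
        tensmx X X - tensmx Y Y - w *: (tensmx X Y + tensmx Y X)].
Proof. by move=> w2; split; apply/matrixP => i j; rewrite !mxE; ring: w2. Qed.

(** For [Z] = I_z the left side is - E_22 + E_33, the matrix part of [F_r3th3], which is thus
    local. *)
Lemma tensmx_diag (K : fieldType) (Z : 'M[K]_2) :
  (2 : K) != 0 ->
  - tensmx (2^-1 *: 1%:M + Z) (2^-1 *: 1%:M - Z)
    + tensmx (2^-1 *: 1%:M - Z) (2^-1 *: 1%:M + Z) =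
  tensmx 1%:M Z - tensmx Z 1%:M.
Proof.
move=> h2; apply/matrixP => i j; rewrite [LHS]mxE [in RHS]mxE.
by rewrite !mxE; field.
Qed.

(* With [w = i], [c = cos t] and [s = sin t], [c - w * s] and [c + w * s] are
   [cis (- t)] and [cis t]. *)
Lemma phase_combination (K : comPzRingType) m n (w c s a : K)
    (U W iU iW : 'M[K]_(m, n)) :
  w * w = -1 -> iU = w *: U -> iW = w *: W ->
  [/\ a *: (- (c - w * s) *: (U - w *: W) + (c + w * s) *: (U + w *: W)) =
        (2 * a) *: (s *: iU + c *: iW),
      (w * a) *: ((c - w * s) *: (U - w *: W) + (c + w * s) *: (U + w *: W)) =
        (2 * a) *: (c *: iU - s *: iW),
      a *: (- (c - w * s) *: (U + w *: W) + (c + w * s) *: (U - w *: W)) =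
        (- (2 * a)) *: (c *: iW - s *: iU) &
      (4 * w * a) *:
        (- (c - w * s) *: (U + w *: W) - (c + w * s) *: (U - w *: W)) =
        (- (8 * a)) *: (s *: iW + c *: iU)].
Proof.
by move=> w2 -> ->; split; apply/matrixP => i j; rewrite !mxE; ring: w2.
Qed.

(** The map (U, W) -> (s U + c W, c U - s W) is a reflection, hence its own inverse. *)
Lemma rotation_inverse (K : comPzRingType) m n (c s : K) (U W : 'M[K]_(m, n)) :
  c ^+ 2 + s ^+ 2 = 1 ->
  U = s *: (s *: U + c *: W) + c *: (c *: U - s *: W) /\
  W = c *: (s *: U + c *: W) - s *: (c *: U - s *: W).
Proof.
move=> cs1; have c2 : c ^+ 2 = 1 - s ^+ 2 by rewrite -cs1 addrK.
by split; apply/matrixP => i j; rewrite !mxE; ring: c2.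
Qed.

Lemma cisE (R : realType) (t : R) : cis t = (cos t)%:C + imag R * (sin t)%:C.
Proof. exact: complexE. Qed.

Lemma cisNE (R : realType) (t : R) :
  cis (- t) = (cos t)%:C - imag R * (sin t)%:C.
Proof. by rewrite cisE cosN sinN rmorphN mulrN. Qed.

Lemma E23_spin (R : realType) :
  E R 2 3 = tensmx (spin_x R) (spin_x R) + tensmx (spin_y R) (spin_y R)
    - imag R *: (tensmx (spin_x R) (spin_y R) - tensmx (spin_y R) (spin_x R)).
Proof.
have := @E_tens R 0 1 1 0; rewrite delta01_spin delta10_spin => ->.
by have [-> _ _ _] := tensmx_square (spin_x R) (spin_y R) (imagM R).
Qed.

Lemma E32_spin (R : realType) :
  E R 3 2 = tensmx (spin_x R) (spin_x R) + tensmx (spin_y R) (spin_y R)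
    + imag R *: (tensmx (spin_x R) (spin_y R) - tensmx (spin_y R) (spin_x R)).
Proof.
have := @E_tens R 1 0 0 1; rewrite delta01_spin delta10_spin => ->.
by have [_ -> _ _] := tensmx_square (spin_x R) (spin_y R) (imagM R).
Qed.

Lemma E14_spin (R : realType) :
  E R 1 4 = tensmx (spin_x R) (spin_x R) - tensmx (spin_y R) (spin_y R)
    + imag R *: (tensmx (spin_x R) (spin_y R) + tensmx (spin_y R) (spin_x R)).
Proof.
have := @E_tens R 0 1 0 1; rewrite delta01_spin => ->.
by have [_ _ -> _] := tensmx_square (spin_x R) (spin_y R) (imagM R).
Qed.

Lemma E41_spin (R : realType) :
  E R 4 1 = tensmx (spin_x R) (spin_x R) - tensmx (spin_y R) (spin_y R)
    - imag R *: (tensmx (spin_x R) (spin_y R) + tensmx (spin_y R) (spin_x R)).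
Proof.
have := @E_tens R 1 0 1 0; rewrite delta10_spin => ->.
by have [_ _ _ ->] := tensmx_square (spin_x R) (spin_y R) (imagM R).
Qed.

(** This and [i_tensB] supply the hypotheses [iU = w *: U] and [iW = w *: W] of
    [phase_combination]. *)
Lemma i_tensD (R : realType) (A B C D : 'M[R[i]]_2) :
  i_tens A B + i_tens C D = imag R *: (tensmx A B + tensmx C D).
Proof. by rewrite scalerDr. Qed.

Lemma i_tensB (R : realType) (A B C D : 'M[R[i]]_2) :
  i_tens A B - i_tens C D = imag R *: (tensmx A B - tensmx C D).
Proof. by rewrite scalerBr. Qed.

(** Here, as in the next four lemmas, every scalar is the image of a real number, so a real subspace
    can absorb it, or cancel it when nonzero. *)
Lemma F_r2r3_spin (R : realType) (r2 th3 : R) :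
  F_r2r3 r2 th3 = (4 * sinh (2 * r2))%:C *:
    ((sin th3)%:C *:
       (i_tens (spin_x R) (spin_x R) + i_tens (spin_y R) (spin_y R)) +
     (cos th3)%:C *:
       (i_tens (spin_x R) (spin_y R) - i_tens (spin_y R) (spin_x R))).
Proof.
rewrite /F_r2r3 E23_spin E32_spin cisNE cisE.
have [H _ _ _] := phase_combination (cos th3)%:C (sin th3)%:C
  (2 * sinh (2 * r2))%:C (imagM R)
  (i_tensD (spin_x R) (spin_x R) (spin_y R) (spin_y R))
  (i_tensB (spin_x R) (spin_y R) (spin_y R) (spin_x R)).
apply: etrans H _; congr (_ *: _).
by rewrite -!(rmorph_nat (real_complex R)) -!(rmorphM, rmorphN);
  congr (_%:C); ring.
Qed.

Lemma F_r2th3_spin (R : realType) (r2 r3 th3 : R) :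
  F_r2th3 r2 r3 th3 = (2 * (sin (2 * r3) * sinh (2 * r2)))%:C *:
    ((cos th3)%:C *:
       (i_tens (spin_x R) (spin_x R) + i_tens (spin_y R) (spin_y R)) -
     (sin th3)%:C *:
       (i_tens (spin_x R) (spin_y R) - i_tens (spin_y R) (spin_x R))).
Proof.
rewrite /F_r2th3 E23_spin E32_spin cisNE cisE.
have [_ H _ _] := phase_combination (cos th3)%:C (sin th3)%:C
  (sin (2 * r3) * sinh (2 * r2))%:C (imagM R)
  (i_tensD (spin_x R) (spin_x R) (spin_y R) (spin_y R))
  (i_tensB (spin_x R) (spin_y R) (spin_y R) (spin_x R)).
apply: etrans H _; congr (_ *: _).
by rewrite -!(rmorph_nat (real_complex R)) -!(rmorphM, rmorphN);
  congr (_%:C); ring.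
Qed.

Lemma D_spin (R : realType) (r2 th2 : R) :
  D r2 th2 = (- (4 * sinh (2 * r2) ^+ 2))%:C *:
    ((cos th2)%:C *:
       (i_tens (spin_x R) (spin_y R) + i_tens (spin_y R) (spin_x R)) -
     (sin th2)%:C *:
       (i_tens (spin_x R) (spin_x R) - i_tens (spin_y R) (spin_y R))).
Proof.
rewrite /D E14_spin E41_spin cisNE cisE.
have [_ _ H _] := phase_combination (cos th2)%:C (sin th2)%:C
  (2 * sinh (2 * r2) ^+ 2)%:C (imagM R)
  (i_tensB (spin_x R) (spin_x R) (spin_y R) (spin_y R))
  (i_tensD (spin_x R) (spin_y R) (spin_y R) (spin_x R)).
apply: etrans H _; congr (_ *: _).
by rewrite -!(rmorph_nat (real_complex R)) -!(rmorphM, rmorphN);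
  congr (_%:C); ring.
Qed.

Lemma D_tilde_spin (R : realType) (r2 th2 : R) :
  D_tilde r2 th2 = (- (8 * sinh (2 * r2)))%:C *:
    ((sin th2)%:C *:
       (i_tens (spin_x R) (spin_y R) + i_tens (spin_y R) (spin_x R)) +
     (cos th2)%:C *:
       (i_tens (spin_x R) (spin_x R) - i_tens (spin_y R) (spin_y R))).
Proof.
rewrite /D_tilde E14_spin E41_spin cisNE cisE.
have [_ _ _ H] := phase_combination (cos th2)%:C (sin th2)%:C
  (sinh (2 * r2))%:C (imagM R)
  (i_tensB (spin_x R) (spin_x R) (spin_y R) (spin_y R))
  (i_tensD (spin_x R) (spin_y R) (spin_y R) (spin_x R)).
apply: etrans H _; congr (_ *: _).
by rewrite -!(rmorph_nat (real_complex R)) -!(rmorphM, rmorphN);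
  congr (_%:C); ring.
Qed.

Lemma F_r3th3_spin (R : realType) (r2 r3 : R) :
  F_r3th3 r2 r3 = (sin (2 * r3) * sinh (2 * r2) ^+ 2)%:C *: (iIz2 R - iIz1 R).
Proof.
have E22 := @E_tens R 0 0 1 1; have E33 := @E_tens R 1 1 0 0.
rewrite /F_r3th3 E22 E33 delta00_spin delta11_spin.
rewrite tensmx_diag ?pnatr_eq0 // mulrC -scalerA scalerBr.
by [].
Qed.

(** * Recovering spin products from rotated pairs and their brackets *)

Lemma rotation_mem (R : realType) n (V : set 'M[R[i]]_n) (t a b : R) U W :
  real_subspace V -> a != 0 -> b != 0 ->
  V (a%:C *: ((sin t)%:C *: U + (cos t)%:C *: W)) ->
  V (b%:C *: ((cos t)%:C *: U - (sin t)%:C *: W)) -> V U /\ V W.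
Proof.
(* The two prefactors may differ, so each is cancelled before the reflection is inverted. *)
move=> hV a0 b0 /(real_subspaceZV hV a0) V1 /(real_subspaceZV hV b0) V2.
have cs1 : (cos t)%:C ^+ 2 + (sin t)%:C ^+ 2 = 1 :> R[i].
  by rewrite -!rmorphXn -rmorphD cos2Dsin2.
have [UE WE] := rotation_inverse U W cs1; split.
- by rewrite UE; apply: real_subspaceD => //; exact: real_subspaceZ.
- by rewrite WE; apply: real_subspaceB => //; exact: real_subspaceZ.
Qed.

Lemma addsub_mem (R : realType) n (V : set 'M[R[i]]_n) X Y :
  real_subspace V -> V (X + Y) -> V (X - Y) -> V X /\ V Y.
Proof.
move=> hV V1 V2; have two : (2 : R) != 0 by rewrite pnatr_eq0.
split; apply: (real_subspaceZV hV two); rewrite rmorph_nat scaler_nat mulr2n.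
- by have := real_subspaceD hV V1 V2; rewrite addrACA subrr addr0.
- by have := real_subspaceB hV V1 V2; rewrite opprB addrC addrA subrK.
Qed.

(** The bracket kills the term with first factor [X], so a single product survives from each
    pair. *)
Lemma bracket_fst_same (R : realType) (X Y Z : 'M[R[i]]_2) :
  imag R *: bracket X Y = Z ->
  [/\ bracket (i_tens X 1%:M) (i_tens X X + i_tens Y Y) = i_tens Z Y,
      bracket (i_tens X 1%:M) (i_tens X X - i_tens Y Y) = - i_tens Z Y &
      bracket (i_tens X 1%:M) (i_tens X Y - i_tens Y X) = - i_tens Z X].
Proof.
move=> XY.
have XX C : bracket (i_tens X 1%:M) (i_tens X C) = 0.
  by rewrite bracket_i_tens_fst bracketxx scaler0 /i_tens tens0mx scaler0.
by split; rewrite bracketDr ?bracketNr XX add0r bracket_i_tens_fst XY.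
Qed.

Lemma bracket_snd_same (R : realType) (X Y Z : 'M[R[i]]_2) :
  imag R *: bracket X Y = Z ->
  bracket (i_tens 1%:M X) (i_tens X X + i_tens Y Y) = i_tens Y Z /\
  bracket (i_tens 1%:M X) (i_tens X Y - i_tens Y X) = i_tens X Z.
Proof.
move=> XY.
have XX C : bracket (i_tens 1%:M X) (i_tens C X) = 0.
  by rewrite bracket_i_tens_snd bracketxx scaler0 i_tens0r.
split; first by rewrite bracketDr XX add0r bracket_i_tens_snd XY.
by rewrite bracketDr bracketNr XX oppr0 addr0 bracket_i_tens_snd XY.
Qed.

(** Bracketing with [A] is linear, so it turns the rotated pair (U, W) into the same rotation of
    (U', W'). *)
Lemma bracket_rotation_mem (R : realType) n (V : set 'M[R[i]]_n) (t a b : R)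
    A U W U' W' :
  real_subspace V -> a != 0 -> b != 0 -> bracket A U = U' -> bracket A W = W' ->
  V (bracket A (a%:C *: ((sin t)%:C *: U + (cos t)%:C *: W))) ->
  V (bracket A (b%:C *: ((cos t)%:C *: U - (sin t)%:C *: W))) -> V U' /\ V W'.
Proof.
move=> hV a0 b0 <- <-; rewrite !bracketZr !bracketDr bracketNr !bracketZr.
exact: rotation_mem.
Qed.

(** Since [B] kills W', the double bracket is - a s U''. This is where sin(th3) must be nonzero. *)
Lemma double_bracket_mem (R : realType) n (V : set 'M[R[i]]_n) (a s c : R)
    A B U W U' W' U'' :
  real_subspace V -> a != 0 -> s != 0 ->
  bracket A U = U' -> bracket A W = W' ->
  bracket B U' = U'' -> bracket B W' = 0 ->
  V (bracket (bracket A (a%:C *: (s%:C *: U + c%:C *: W))) B) -> V U''.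
Proof.
move=> hV a0 s0 AU AW BU BW.
have -> : bracket A (a%:C *: (s%:C *: U + c%:C *: W)) =
    a%:C *: (s%:C *: U' + c%:C *: W').
  by rewrite bracketZr bracketDr !bracketZr AU AW.
rewrite bracket_anti bracketZr bracketDr !bracketZr BU BW scaler0 addr0.
move=> /(real_subspaceN hV); rewrite opprK.
by move=> /(real_subspaceZV hV a0)/(real_subspaceZV hV s0).
Qed.

(** * The generated algebra and its real span *)

Lemma curvature_mem (R : realType) (V : set 'M[R[i]]_4) (r2 th2 r3 th3 : R) :
  real_subspace V -> C1 R `<=` V ->
  (forall A B, spins R A -> spins R B -> V (i_tens A B)) ->
  curvature_set r2 th2 r3 th3 `<=` V.
Proof.
move=> hV C1V Vspin.
have sx : spins R (spin_x R) by left; left.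
have sy : spins R (spin_y R) by left; right.
have [Vxx Vyy] := (Vspin _ _ sx sx, Vspin _ _ sy sy).
have [Vxy Vyx] := (Vspin _ _ sx sy, Vspin _ _ sy sx).
have hZ := real_subspaceZ hV.
have hD := real_subspaceD hV.
have hB Y Z : V Y -> V Z -> V (Y - Z) := real_subspaceB hV.
have [VUp VUm] := (hD _ _ Vxx Vyy, hB _ _ Vxx Vyy).
have [VWp VWm] := (hD _ _ Vxy Vyx, hB _ _ Vxy Vyx).
move=> _ [[[[->|->]|->]|->]|->].
- rewrite F_r2r3_spin; exact: (hZ _ _ (hD _ _ (hZ _ _ VUp) (hZ _ _ VWm))).
- rewrite F_r2th3_spin; exact: (hZ _ _ (hB _ _ (hZ _ _ VUp) (hZ _ _ VWm))).
- rewrite F_r3th3_spin; apply: (hZ); apply: (hB); apply: C1V; first by right.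
  by left; left; left; right.
- rewrite D_spin; exact: (hZ _ _ (hB _ _ (hZ _ _ VWp) (hZ _ _ VUm))).
- rewrite D_tilde_spin; exact: (hZ _ _ (hD _ _ (hZ _ _ VWp) (hZ _ _ VUm))).
Qed.

Lemma C1_su (R : realType) : C1 R `<=` su R 4.
Proof.
have adj1 : (1%:M : 'M[R[i]]_2)^t* = 1%:M by rewrite trmx1 map_mx1.
have su1 A : spins R A -> su R 4 (i_tens A 1%:M).
  move=> sA; apply: su_i_tens; [exact: spin_hermitian | exact: adj1 |].
  by rewrite (spin_traceless sA) mul0r.
have su2 A : spins R A -> su R 4 (i_tens 1%:M A).
  move=> sA; apply: su_i_tens; [exact: adj1 | exact: spin_hermitian |].
  by rewrite (spin_traceless sA) mulr0.
move=> _ [[[[[->|->]|->]|->]|->]|->].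
- by apply: su1; left; left.
- by apply: su1; left; right.
- by apply: su1; right.
- by apply: su2; left; left.
- by apply: su2; left; right.
- by apply: su2; right.
Qed.

Lemma generated_su (R : realType) (r2 th2 r3 th3 : R) :
  iterated_brackets (curvature_set r2 th2 r3 th3 `|` local_algebra R)
    `<=` su R 4.
Proof.
have hsu := su_subspace R 4.
have Vspin A B : spins R A -> spins R B -> su R 4 (i_tens A B).
  move=> sA sB; apply: su_i_tens; rewrite ?spin_hermitian //.
  by rewrite (spin_traceless sA) mul0r.
move=> X; elim=> {X} [X [cX|lX]|X Y _ sX _ sY].
- exact: (curvature_mem hsu (@C1_su R) Vspin) cX.
- exact: (real_span_min hsu (@C1_su R)) lX.
- exact: su_bracket.
Qed.

(** Irreducibility made explicit, starting from N zy: up to sign, I_y1 and I_x1 turn the first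
    factor z into x and y, and then I_z2 and I_x2 turn the second factor y into x and z. *)
Lemma spins_of_bracket_closed (R : realType) (V : set 'M[R[i]]_4) :
  real_subspace V -> (forall A X, C1 R A -> V X -> V (bracket A X)) ->
  V (i_tens (spin_z R) (spin_y R)) ->
  forall A B, spins R A -> spins R B -> V (i_tens A B).
Proof.
move=> hV Vbr Vzy A B sA sB.
have [xy yz zx] := spin_bracket R.
have xz : imag R *: bracket (spin_x R) (spin_z R) = spin_y R.
  by rewrite bracket_anti scalerN zx opprK.
have zy : imag R *: bracket (spin_z R) (spin_y R) = spin_x R.
  by rewrite bracket_anti scalerN yz opprK.
have VN C C' : V (- i_tens C C') -> V (i_tens C C').
  by move=> /(real_subspaceN hV); rewrite opprK.
have VAy : V (i_tens A (spin_y R)).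
  case: sA => [[->|->]|->].
  - have iIy1_C1 : C1 R (iIy1 R) by do 4!left; right.
    have := Vbr _ _ iIy1_C1 Vzy.
    by rewrite bracket_i_tens_fst yz i_tensNl; exact: VN.
  - have iIx1_C1 : C1 R (iIx1 R) by do 5!left.
    by have := Vbr _ _ iIx1_C1 Vzy; rewrite bracket_i_tens_fst xz; exact.
  - exact: Vzy.
case: sB => [[->|->]|->].
- have iIz2_C1 : C1 R (iIz2 R) by right.
  by have := Vbr _ _ iIz2_C1 VAy; rewrite bracket_i_tens_snd zy; exact.
- exact: VAy.
- have iIx2_C1 : C1 R (iIx2 R) by do 2!left; right.
  have := Vbr _ _ iIx2_C1 VAy.
  by rewrite bracket_i_tens_snd xy i_tensNr; exact: VN.
Qed.

Lemma sinh_neq0 (R : realType) (x : R) : x != 0 -> sinh x != 0.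
Proof.
apply: contra_neq => /eqP; rewrite mulf_eq0 invr_eq0 pnatr_eq0 orbF subr_eq0.
by move=> /eqP/expR_inj/eqP; rewrite -addr_eq0 -mulr2n mulrn_eq0 => /eqP.
Qed.

Lemma choice_sub_generated (R : realType) (r2 th2 r3 th3 : R) :
  C1 R `|` C2 r2 th2 r3 th3 `|` C3 r2 r3 th3 `<=`
  iterated_brackets (curvature_set r2 th2 r3 th3 `|` local_algebra R).
Proof.
pose S := curvature_set r2 th2 r3 th3 `|` local_algebra R.
have gC1 A : C1 R A -> iterated_brackets S A.
  by move=> C1A; apply: IterGen; right; exact: sub_real_span.
have gcurv A : curvature_set r2 th2 r3 th3 A -> iterated_brackets S A.
  by move=> cA; apply: IterGen; left.
have gx1 : iterated_brackets S (iIx1 R) by apply: gC1; do 5!left.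
have gx2 : iterated_brackets S (iIx2 R) by apply: gC1; do 2!left; right.
have gF : iterated_brackets S (F_r2r3 r2 th3) by apply: gcurv; do 4!left.
have gF' : iterated_brackets S (F_r2th3 r2 r3 th3).
  by apply: gcurv; do 3!left; right.
move=> B [[C1B|[[[->|->]|->]|->]]|[[[[->|->]|->]|->]|->]].
- exact: gC1.
- exact: gF.
- exact: gF'.
- by apply: gcurv; left; right.
- by apply: gcurv; right.
- exact: IterBracket gx1 gF.
- exact: IterBracket gx1 gF'.
- exact: IterBracket gx2 gF.
- exact: IterBracket gx2 gF'.
- exact: IterBracket (IterBracket gx1 gF) gx2.
Qed.

(** The prefactors of [D] and [D_tilde] are nonzero multiples of the square of sinh(2 r2) and of
    sinh(2 r2), so r2 != 0 suffices to undo the rotation by th2. *)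
Lemma D_span (R : realType) (V : set 'M[R[i]]_4) (r2 th2 : R) :
  real_subspace V -> r2 != 0 -> V (D r2 th2) -> V (D_tilde r2 th2) ->
  V (i_tens (spin_x R) (spin_y R) + i_tens (spin_y R) (spin_x R)) /\
  V (i_tens (spin_x R) (spin_x R) - i_tens (spin_y R) (spin_y R)).
Proof.
move=> hV r2_neq0; rewrite D_spin D_tilde_spin => VD VD'.
have sinh0 : sinh (2 * r2) != 0.
  by apply: sinh_neq0; rewrite mulf_neq0 ?pnatr_eq0.
(* [D_tilde] comes first because it carries the combination s U + c W. *)
apply: rotation_mem hV _ _ VD' VD; rewrite oppr_eq0 mulf_neq0 ?pnatr_eq0 //.
exact: expf_neq0.
Qed.

Lemma real_span_generated (R : realType) (r2 th2 r3 th3 : R) : r2 != 0 ->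
  real_span (iterated_brackets
    (curvature_set r2 th2 r3 th3 `|` local_algebra R)) = su R 4.
Proof.
move=> r2_neq0; pose S := curvature_set r2 th2 r3 th3 `|` local_algebra R.
pose V := real_span (iterated_brackets S).
have hV : real_subspace V := real_span_subspace _.
have C1S A : C1 R A -> S A by move=> C1A; right; exact: sub_real_span.
have SV A : S A -> V A by move=> SA; apply: sub_real_span; exact: IterGen.
have Vbr A X : C1 R A -> V X -> V (bracket A X).
  by move=> /C1S SA; exact: real_span_bracket_gen.
have curvV A : curvature_set r2 th2 r3 th3 A -> V A.
  by move=> cA; apply: SV; left.
apply/seteqP; split.
  exact: (real_span_min (su_subspace R 4) (@generated_su R r2 th2 r3 th3)).
have [VD VD'] : V (D r2 th2) /\ V (D_tilde r2 th2).
  by split; apply: curvV; [left; right | right].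
have [_ VUm] := D_span hV r2_neq0 VD VD'.
(* As i [I_x, I_y] = - I_z, the bracket of I_x1 with N xx - N yy is exactly N zy. *)
have Vzy : V (i_tens (spin_z R) (spin_y R)).
  have iIx1_C1 : C1 R (iIx1 R) by do 5!left.
  have [xy _ _] := spin_bracket R.
  have [_ Um _] := bracket_fst_same xy.
  rewrite i_tensNl opprK in Um; rewrite -Um.
  exact: Vbr iIx1_C1 VUm.
apply: (su4_sub hV); first by move=> A C1A; exact: SV (C1S _ C1A).
exact: spins_of_bracket_closed hV Vbr Vzy.
Qed.

(** * The explicit spanning set *)

Lemma real_span_choice (R : realType) (r2 th2 r3 th3 : R) :
  r2 != 0 -> sin (2 * r3) != 0 -> sin th3 != 0 ->
  real_span (C1 R `|` C2 r2 th2 r3 th3 `|` C3 r2 r3 th3) = su R 4.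
Proof.
move=> r2_neq0 sin2r3 sinth3.
pose S := C1 R `|` C2 r2 th2 r3 th3 `|` C3 r2 r3 th3; pose V := real_span S.
have hV : real_subspace V := real_span_subspace _.
have SV : S `<=` V := @sub_real_span _ _ _.
apply/seteqP; split.
  apply: (real_span_min (su_subspace R 4)) => X SX.
  exact: (generated_su (choice_sub_generated SX)).
have VN X : V (- X) -> V X by move=> /(real_subspaceN hV); rewrite opprK.
have sinh0 : sinh (2 * r2) != 0.
  by apply: sinh_neq0; rewrite mulf_neq0 ?pnatr_eq0.
have a0 : 4 * sinh (2 * r2) != 0 by rewrite mulf_neq0 ?pnatr_eq0.
have b0 : 2 * (sin (2 * r3) * sinh (2 * r2)) != 0.
  by rewrite mulf_neq0 ?pnatr_eq0 // mulf_neq0.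
have [xy yz zx] := spin_bracket R.
have [U1 _ W1] := bracket_fst_same xy; have [U2 W2] := bracket_snd_same xy.
have VF : V (F_r2r3 r2 th3) by apply: SV; left; right; do 3!left.
have VF' : V (F_r2th3 r2 r3 th3) by apply: SV; left; right; do 2!left; right.
have VD : V (D r2 th2) by apply: SV; left; right; left; right.
have VD' : V (D_tilde r2 th2) by apply: SV; left; right; right.
have V1F : V (bracket (iIx1 R) (F_r2r3 r2 th3)) by apply: SV; right; do 4!left.
have V1F' : V (bracket (iIx1 R) (F_r2th3 r2 r3 th3)).
  by apply: SV; right; do 3!left; right.
have V2F : V (bracket (iIx2 R) (F_r2r3 r2 th3)).
  by apply: SV; right; do 2!left; right.
have V2F' : V (bracket (iIx2 R) (F_r2th3 r2 r3 th3)).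
  by apply: SV; right; left; right.
have V12F : V (bracket (bracket (iIx1 R) (F_r2r3 r2 th3)) (iIx2 R)).
  by apply: SV; right; right.
have [VWp VUm] := D_span hV r2_neq0 VD VD'.
rewrite F_r2r3_spin in VF V1F V2F V12F; rewrite F_r2th3_spin in VF' V1F' V2F'.
have [VUp VWm] := rotation_mem hV a0 b0 VF VF'.
have [Vxx Vyy] := addsub_mem hV VUp VUm.
have [Vxy Vyx] := addsub_mem hV VWp VWm.
have [VU1 VW1] := bracket_rotation_mem hV a0 b0 U1 W1 V1F V1F'.
have [VU2 VW2] := bracket_rotation_mem hV a0 b0 U2 W2 V2F V2F'.
(* The four brackets yield - N zy, N zx, - N yz and - N xz; the minus signs are removed below with
   [VN]. *)
rewrite i_tensNl in VU1; rewrite i_tensNl opprK in VW1.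
rewrite i_tensNr in VU2; rewrite i_tensNr in VW2.
(* I_x2 sends - N zy to N zz and kills N zx, so the double bracket isolates N zz. *)
have U12 : bracket (i_tens 1%:M (spin_x R)) (i_tens (- spin_z R) (spin_y R)) =
    i_tens (spin_z R) (spin_z R).
  apply: etrans (bracket_i_tens_snd _ _ _) _; rewrite xy; exact: i_tensNN.
have W12 :
    bracket (i_tens 1%:M (spin_x R)) (- i_tens (- spin_z R) (spin_x R)) = 0.
  by rewrite bracketNr bracket_i_tens_snd bracketxx scaler0 i_tens0r oppr0.
have Vzz : V (i_tens (spin_z R) (spin_z R)) :=
  double_bracket_mem hV a0 sinth3 U1 W1 U12 W12 V12F.
have {}VU1 := VN _ VU1; have {}VU2 := VN _ VU2; have {}VW2 := VN _ VW2.
apply: (su4_sub hV); first by move=> A C1A; apply: SV; left; left.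
move=> A B [[->|->]|->] [[->|->]|->].
- exact: Vxx.
- exact: Vxy.
- exact: VW2.
- exact: Vyx.
- exact: Vyy.
- exact: VU2.
- exact: VW1.
- exact: VU1.
- exact: Vzz.
Qed.

(** The hypotheses exclude degenerate parameters. At r2 = 0 all five curvature matrices vanish. The
    choice lists 15 matrices, the dimension of su(4), so none may vanish; but [F_r2th3] does when
    sin(2 r3) = 0, and the double bracket does when sin(th3) = 0. *)
Theorem mainTheorem2 (R : realType) (r2 th2 r3 th3 : R) :
  let generated :=
    iterated_brackets (curvature_set r2 th2 r3 th3 `|` local_algebra R) in
  let choice := C1 R `|` C2 r2 th2 r3 th3 `|` C3 r2 r3 th3 in
  (r2 != 0 -> real_span generated = su R 4) /\
  choice `<=` generated /\
  (r2 != 0 -> sin (2 * r3) != 0 -> sin th3 != 0 ->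
     real_span choice = su R 4).
Proof.
split; first exact: real_span_generated.
by split; [exact: choice_sub_generated | exact: real_span_choice].
Qed.
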